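(* Let the setting described in the context hold and assume $C_{\mathrm{DRO}}>-\infty$. Let $(\tau,\boldsymbol\xi_{\mathrm{in}},\boldsymbol\xi_{\mathrm{eq}})$ be feasible for (Dual), where $\mathrm{supp}(\tau)$ is a finite set, and let $\mathcal V$ be an arbitrary finite set satisfying $\mathrm{supp}(\tau)\subseteq\mathcal V\subset\mathcal S_2^*$. Consider the following constraints for $\boldsymbol x\in\mathcal S_1$, $f_1,\dots,f_d\in\mathcal C_{\mathrm{cvx}}(\mathbb R)$ with respect to a tolerance parameter $\varepsilon_{\mathrm{OT}}>0$: (C1) $\langle\mathbf Q\boldsymbol x+\mathbf b,\boldsymbol\lambda\rangle+\sum_{i=1}^d f_i(\langle\mathbf p_i,\boldsymbol\lambda\rangle)=0$ for all $\boldsymbol\lambda\in\mathrm{supp}(\tau)$; (C2) $\langle\mathbf Q\boldsymbol x+\mathbf b,\boldsymbol\lambda\rangle+\sum_{i=1}^d f_i(\langle\mathbf p_i,\boldsymbol\lambda\rangle)\le0$ for all $\boldsymbol\lambda\in\mathcal V\setminus\mathrm{supp}(\tau)$; (C3) $\langle\mathbf L_{\mathrm{in}}\boldsymbol x-\mathbf q_{\mathrm{in}},\boldsymbol\xi_{\mathrm{in}}\rangle=0$; (C4) $\big\langle\mathbf c_1+\int_{\mathcal S_2^*}\mathbf Q^{\mathsf T}\boldsymbol\lambda\,\tau(\mathrm d\boldsymbol\lambda)-\mathbf L_{\mathrm{in}}^{\mathsf T}\boldsymbol\xi_{\mathrm{in}}-\mathbf L_{\mathrm{eq}}^{\mathsf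 T}\boldsymbol\xi_{\mathrm{eq}},\boldsymbol x\big\rangle=0$; and for $i=1,\dots,d$: (C5) $-\int_{\Omega_i}\sup_{z\in\mathbb R}\{z\omega-f_i(z)\}\,\mu_i(\mathrm d\omega)-\int_{\mathbb R}f_i\,\mathrm d(\langle\mathbf p_i,\cdot\rangle\sharp\tau)\ge\mathrm{OT}_{\mu_i}(\langle\mathbf p_i,\cdot\rangle\sharp\tau)-\varepsilon_{\mathrm{OT}}$; (C6) $\partial f_i(z)\subseteq\Omega_i$ for all $z\in\mathbb R$. Moreover, for any $\boldsymbol x\in\mathcal S_1$ and $f_1,\dots,f_d\in\mathcal C_{\mathrm{cvx}}(\mathbb R)$ let $$\mathrm{vio}(\boldsymbol x,f_1,\dots,f_d):=\sup_{\boldsymbol\lambda\in\mathcal S_2^*}\Big\{\langle\mathbf Q\boldsymbol x+\mathbf b,\boldsymbol\lambda\rangle+\sum_{i=1}^d f_i(\langle\mathbf p_i,\boldsymbol\lambda\rangle)\Big\}.\qquad(\ast)$$ Then: (i) For any $\boldsymbol x\in\mathcal S_1$, $f_1,\dots,f_d\in\mathcal C_{\mathrm{cvx}}(\mathbb R)$ that satisfy (C1)–(C6), it holds that $0\le\mathrm{vio}(\boldsymbol x,f_1,\dots,f_d)<\infty$, and a maximizer of $(\ast)$ is attained in $\mathcal V_{\mathrm{extr}}$. (ii) Assume that $\boldsymbol x\in\mathcal S_1$, $f_1,\dots,f_d\in\mathcal C_{\mathrm{cvx}}(\mathbb R)$ satisfy (C1)–(C6), and define $\varepsilon_{\mathrm{sub}}:=\mathrm{vio}(\boldsymbol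 x,f_1,\dots,f_d)+d\,\varepsilon_{\mathrm{OT}}$. Then $(\tau,\boldsymbol\xi_{\mathrm{in}},\boldsymbol\xi_{\mathrm{eq}})$ is an $\varepsilon_{\mathrm{sub}}$-optimizer of (Dual). Moreover, if $\mathrm{vio}(\boldsymbol x,f_1,\dots,f_d)>0$, then the set $\{\boldsymbol\lambda\in\mathcal S_2^*:\langle\mathbf Q\boldsymbol x+\mathbf b,\boldsymbol\lambda\rangle+\sum_{i=1}^d f_i(\langle\mathbf p_i,\boldsymbol\lambda\rangle)>0\}$ is disjoint from $\mathcal V$.
   Context: Notation. $\mathbb N_0=\mathbb N\cup\{0\}$, $\mathbb R_+=[0,\infty)$, $\mathbb R_-=(-\infty,0]$; vector inequalities are componentwise; $\langle\cdot,\cdot\rangle$ is the Euclidean inner product. For closed $\mathcal Y\subseteq\mathbb R^n$, $\mathcal P(\mathcal Y)$ is the set of Borel probability measures on $\mathcal Y$ and $\mathcal P_1(\mathcal Y)$ the subset of those with finite first moment; $\mathrm{supp}$ denotes the support, $g\sharp\mu$ the pushforward of $\mu$ by $g$. $\mathcal C_{\mathrm{cvx}}(\mathbb R)$ is the set of continuous convex functions $\mathbb R\to\mathbb R$, and $\partial f(z)$ is the convex subdifferential. A polyhedral convex set is a finite intersection of closed half-spaces; for such $P$, $\mathrm{extr}(P)$ is its set of extreme points, $\mathrm{recc}(P)$ its recession cone, and $\mathrm{line}(P)=\mathrm{recc}(P)\cap(-\mathrm{recc}(P))$ its lineality space. An $\varepsilon$-optimizer is a feasible point whose objective is within $\varepsilon$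 of the optimal value. Setting. Let $d\ge 2$ be an integer, $\Omega_i=[\underline\omega_i,\overline\omega_i]$ with $-\infty<\underline\omega_i\le\overline\omega_i<\infty$, $\mu_i\in\mathcal P(\Omega_i)$ ($i=1,\dots,d$), and $\boldsymbol\Omega=\Omega_1\times\cdots\times\Omega_d$. $\Gamma(\mu_1,\dots,\mu_d)$ is the set of $\gamma\in\mathcal P(\boldsymbol\Omega)$ whose marginal on $\Omega_i$ is $\mu_i$ for every $i$. Let $k_1\in\mathbb N$, $\mathbf c_1\in\mathbb R^{k_1}$, $n_{\mathrm{in}},n_{\mathrm{eq}}\in\mathbb N_0$, $\mathbf L_{\mathrm{in}}\in\mathbb R^{n_{\mathrm{in}}\times k_1}$, $\mathbf q_{\mathrm{in}}\in\mathbb R^{n_{\mathrm{in}}}$, $\mathbf L_{\mathrm{eq}}\in\mathbb R^{n_{\mathrm{eq}}\times k_1}$, $\mathbf q_{\mathrm{eq}}\in\mathbb R^{n_{\mathrm{eq}}}$, and assume that $\mathcal S_1:=\{\boldsymbol x\in\mathbb R_+^{k_1}:\mathbf L_{\mathrm{in}}\boldsymbol x\le\mathbf q_{\mathrm{in}},\ \mathbf L_{\mathrm{eq}}\boldsymbol x=\mathbf q_{\mathrm{eq}}\}$ is non-empty. Let $k_2^*\in\mathbb N$, $\mathbf Q\in\mathbb R^{k_2^*\times k_1}$, $\mathbf P\in\mathbb R^{k_2^*\times d}$ with $i$-th column $\mathbf p_i\in\mathbb R^{k_2^*}$, $\mathbf b\in\mathbb R^{k_2^*}$. Let $m_{\mathrm{in}},m_{\mathrm{eq}}\in\mathbb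 N_0$ with $m_{\mathrm{in}}+m_{\mathrm{eq}}=k_2^*$, $k_2\in\mathbb N$, $\mathbf A_{\mathrm{in}}\in\mathbb R^{m_{\mathrm{in}}\times k_2}$, $\mathbf A_{\mathrm{eq}}\in\mathbb R^{m_{\mathrm{eq}}\times k_2}$, $\mathbf c_2\in\mathbb R^{k_2}$, and assume that $\mathcal S_2^*:=\{(\boldsymbol\lambda_{\mathrm{in}}^{\mathsf T},\boldsymbol\lambda_{\mathrm{eq}}^{\mathsf T})^{\mathsf T}:\boldsymbol\lambda_{\mathrm{in}}\in\mathbb R_-^{m_{\mathrm{in}}},\ \boldsymbol\lambda_{\mathrm{eq}}\in\mathbb R^{m_{\mathrm{eq}}},\ \mathbf A_{\mathrm{in}}^{\mathsf T}\boldsymbol\lambda_{\mathrm{in}}+\mathbf A_{\mathrm{eq}}^{\mathsf T}\boldsymbol\lambda_{\mathrm{eq}}\le\mathbf c_2\}\subset\mathbb R^{k_2^*}$ is non-empty. The optimal second-stage cost is $C_2(\boldsymbol x,\boldsymbol\omega):=\max_{\boldsymbol\lambda\in\mathcal S_2^*}\langle\mathbf Q\boldsymbol x+\mathbf P\boldsymbol\omega+\mathbf b,\boldsymbol\lambda\rangle$ for $\boldsymbol x\in\mathcal S_1$, $\boldsymbol\omega\in\boldsymbol\Omega$, and it is assumed that $\sup_{\boldsymbol x\in\mathcal S_1,\boldsymbol\omega\in\boldsymbol\Omega}C_2(\boldsymbol x,\boldsymbol\omega)<\infty$. Let $\mathcal V_{\mathrm{extr}}:=\mathrm{extr}(\mathcal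 S_2^*\cap\mathrm{line}(\mathcal S_2^* )^\perp)$, a finite subset of $\mathcal S_2^*$. $C_{\mathrm{DRO}}:=\inf_{\boldsymbol x\in\mathcal S_1}\big\{\langle\mathbf c_1,\boldsymbol x\rangle+\sup_{\mu\in\Gamma(\mu_1,\dots,\mu_d)}\int_{\boldsymbol\Omega}C_2(\boldsymbol x,\boldsymbol\omega)\,\mu(\mathrm d\boldsymbol\omega)\big\}$. For $\nu\in\mathcal P_1(\mathbb R)$, $\mathrm{OT}_{\mu_i}(\nu):=\inf_{\gamma\in\Gamma(\mu_i,\nu)}\int_{\Omega_i\times\mathbb R}-z\omega\,\gamma(\mathrm d\omega,\mathrm dz)$, where $\Gamma(\mu_i,\nu)$ is the set of couplings of $\mu_i$ and $\nu$. $\langle\mathbf p_i,\cdot\rangle$ denotes the map $\boldsymbol\lambda\mapsto\langle\mathbf p_i,\boldsymbol\lambda\rangle$. Problem (Dual): maximize $\int_{\mathcal S_2^*}\langle\mathbf b,\boldsymbol\lambda\rangle\,\tau(\mathrm d\boldsymbol\lambda)-\big(\sum_{i=1}^d \mathrm{OT}_{\mu_i}(\langle\mathbf p_i,\cdot\rangle\sharp\tau)\big)+\langle\mathbf q_{\mathrm{in}},\boldsymbol\xi_{\mathrm{in}}\rangle+\langle\mathbf q_{\mathrm{eq}},\boldsymbol\xi_{\mathrm{eq}}\rangle$ over $\tau\in\mathcal P_1(\mathcal S_2^* )$, $\boldsymbol\xi_{\mathrm{in}}\in\mathbb R_-^{n_{\mathrm{in}}}$, $\boldsymbol\xi_{\mathrm{eq}}\in\mathbb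 R^{n_{\mathrm{eq}}}$ subject to $\mathbf c_1+\int_{\mathcal S_2^*}\mathbf Q^{\mathsf T}\boldsymbol\lambda\,\tau(\mathrm d\boldsymbol\lambda)\ge \mathbf L_{\mathrm{in}}^{\mathsf T}\boldsymbol\xi_{\mathrm{in}}+\mathbf L_{\mathrm{eq}}^{\mathsf T}\boldsymbol\xi_{\mathrm{eq}}$. *)

(* Defs.v *)
From HB Require Import structures.
From mathcomp Require Import all_boot all_order all_algebra.
From mathcomp Require Import all_classical all_reals all_analysis.

Set Implicit Arguments.
Unset Strict Implicit.
Unset Printing Implicit Defensive.

Import Order.TTheory GRing.Theory Num.Theory.
Import numFieldNormedType.Exports.

Local Open Scope classical_set_scope.
Local Open Scope ring_scope.

Definition dotp (R : realType) n (u v : 'cV[R]_n) : R :=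
  \sum_(i < n) u i 0 * v i 0.

Definition lecv (R : realType) n (u v : 'cV[R]_n) : Prop :=
  forall i, u i 0 <= v i 0.

Definition extreme_points (R : realType) n (A : set 'cV[R]_n) : set 'cV[R]_n :=
  [set x | A x /\ forall (y z : 'cV[R]_n) (t : R), A y -> A z ->
     0 < t < 1 -> x = t *: y + (1 - t) *: z -> y = x /\ z = x].

Definition recession_cone (R : realType) n (A : set 'cV[R]_n) : set 'cV[R]_n :=
  [set r | forall x (t : R), A x -> 0 <= t -> A (x + t *: r)].

Definition lineality (R : realType) n (A : set 'cV[R]_n) : set 'cV[R]_n :=
  [set r | recession_cone A r /\ recession_cone A (- r)].

Definition orthogonal_set (R : realType) n (A : set 'cV[R]_n) : set 'cV[R]_n :=
  [set v | forall r, A r -> dotp v r = 0].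

(* [R^o] is [R] seen as a module over itself, as [convex_function] requires. *)
Definition C_cvx (R : realType) (f : R -> R) : Prop :=
  continuous f /\
  convex_function (setT : set (convex_lmodType R^o)) (f : R^o -> R^o).

Definition subdifferential (R : realType) (f : R -> R) (z : R) : set R :=
  [set s | forall y, f z + s * (y - z) <= f y].

Definition conjugate (R : realType) (f : R -> R) (w : R) : \bar R :=
  ereal_sup [set (z * w - f z)%:E | z in setT].

(* Column vectors with their Borel sigma-algebra. *)
Definition borelcV (R : realType) (n : nat) : measurableType _ :=
  g_sigma_algebraType (@open 'cV[R]_n).

(* A probability measure on a closed [Y] is encoded as a probability measure
   on the ambient space giving mass 1 to [Y]. *)
Definition prob_on d (T : measurableType d) (R : realType)
    (mu : probability T R) (Y : set T) : Prop :=
  mu Y = 1%E.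

(* [`|y|] is the maximum norm; finiteness of the first moment does not depend
   on the choice of a norm. *)
Definition P1_on (R : realType) n (Y : set 'cV[R]_n)
    (mu : probability (borelcV R n) R) : Prop :=
  prob_on mu Y /\ (\int[mu]_(y in Y) (`|y : 'cV[R]_n|)%:E < +oo)%E.

Definition supp (R : realType) n (mu : probability (borelcV R n) R) :
    set 'cV[R]_n :=
  [set x | forall U : set 'cV[R]_n, open U -> U x -> (0 < mu U)%E].

(* [nu] is a set function rather than a bundled measure because the
   pushforwards it is used with are bundled only through a measurability
   proof. *)
Definition coupling (R : realType) (mu nu : set (measurableTypeR R) -> \bar R)
    (g : probability (measurableTypeR R * measurableTypeR R)%type R) : Prop :=
  forall A : set (measurableTypeR R), measurable A ->
    g (A `*` setT) = mu A /\ g (setT `*` A) = nu A.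

Definition OT (R : realType) (Omega : set R)
    (mu nu : set (measurableTypeR R) -> \bar R) : \bar R :=
  ereal_inf [set (\int[g]_(p in Omega `*` setT) (- (p.2 * p.1))%:E)%E
            | g in coupling mu nu].

Definition eps_maximizer (R : realType) (T : Type) (feasible : set T)
    (objective : T -> \bar R) (eps : \bar R) (p : T) : Prop :=
  feasible p /\
  (ereal_sup [set objective q | q in feasible] - eps <= objective p)%E.

(* The number of rows k_2^* of [Q_], [P_] and [b_] is [m_in + m_eq], so that
   the dual vectors split as [col_mx l_in l_eq]. *)
Record dro_data (R : realType) (d k1 n_in n_eq m_in m_eq k2 : nat) := DroData {
  lo : 'I_d -> R;
  hi : 'I_d -> R;
  mu_ : 'I_d -> probability (measurableTypeR R) R;
  c1 : 'cV[R]_k1;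
  L_in : 'M[R]_(n_in, k1);
  q_in : 'cV[R]_n_in;
  L_eq : 'M[R]_(n_eq, k1);
  q_eq : 'cV[R]_n_eq;
  Q_ : 'M[R]_(m_in + m_eq, k1);
  P_ : 'M[R]_(m_in + m_eq, d);
  b_ : 'cV[R]_(m_in + m_eq);
  A_in : 'M[R]_(m_in, k2);
  A_eq : 'M[R]_(m_eq, k2);
  c2 : 'cV[R]_k2
}.

Section Problem.
Context {R : realType} {d k1 n_in n_eq m_in m_eq k2 : nat}.
Context (D : dro_data R d k1 n_in n_eq m_in m_eq k2).

Definition Omega_ (i : 'I_d) : set R := `[lo D i, hi D i].

Definition Omega : set 'cV[R]_d := [set w | forall i, Omega_ i (w i 0)].

Definition Gamma : set (probability (borelcV R d) R) :=
  [set g : probability (borelcV R d) R | prob_on g Omega /\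
    forall (i : 'I_d) (A : set (measurableTypeR R)), measurable A ->
      pushforward g (fun w : 'cV[R]_d => w i 0 : measurableTypeR R) A
      = mu_ D i A].

Definition S1 : set 'cV[R]_k1 :=
  [set x | [/\ lecv 0 x, lecv (L_in D *m x) (q_in D)
             & L_eq D *m x = q_eq D]].

Definition S2 : set 'cV[R]_(m_in + m_eq) :=
  [set l | exists (l_in : 'cV[R]_m_in) (l_eq : 'cV[R]_m_eq),
     [/\ l = col_mx l_in l_eq, lecv l_in 0
       & lecv ((A_in D)^T *m l_in + (A_eq D)^T *m l_eq) (c2 D)]].

(* The maximum defining the second-stage cost is a supremum in [\bar R]; it is
   attained whenever it is finite since [S2] is a polyhedron. *)
Definition C2 (x : 'cV[R]_k1) (w : 'cV[R]_d) : \bar R :=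
  ereal_sup [set (dotp (Q_ D *m x + P_ D *m w + b_ D) l)%:E | l in S2].

Definition V_extr : set 'cV[R]_(m_in + m_eq) :=
  extreme_points (S2 `&` orthogonal_set (lineality S2)).

Definition C_DRO : \bar R :=
  ereal_inf [set ((dotp (c1 D) x)%:E +
      ereal_sup [set (\int[g]_(w in Omega) C2 x w)%E | g in Gamma])%E
    | x in S1].

Definition dro_setting : Prop :=
  [/\ forall i, lo D i <= hi D i,
      forall i, prob_on (mu_ D i) (Omega_ i),
      S1 !=set0,
      S2 !=set0 &
      (ereal_sup [set C2 x w | x in S1 & w in Omega] < +oo)%E].

Definition p_dot (i : 'I_d) (l : 'cV[R]_(m_in + m_eq)) : measurableTypeR R :=
  dotp (col i (P_ D)) l.

Definition nu_ (tau : probability (borelcV R (m_in + m_eq)) R) (i : 'I_d) :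
    set (measurableTypeR R) -> \bar R :=
  pushforward tau (p_dot i).

Definition OT_ (tau : probability (borelcV R (m_in + m_eq)) R) (i : 'I_d) :
    \bar R :=
  OT (Omega_ i) (mu_ D i) (nu_ tau i).

Definition dual_var : Type :=
  (probability (borelcV R (m_in + m_eq)) R * 'cV[R]_n_in * 'cV[R]_n_eq)%type.

Definition mean_QT (tau : probability (borelcV R (m_in + m_eq)) R) :
    'cV[R]_k1 :=
  \col_j \int[tau]_(l in S2) (((Q_ D)^T *m l) j 0).

Definition dual_feasible : set dual_var :=
  [set p | [/\ P1_on S2 p.1.1, lecv p.1.2 0
    & lecv ((L_in D)^T *m p.1.2 + (L_eq D)^T *m p.2)
           (c1 D + mean_QT p.1.1)]].

Definition dual_objective (p : dual_var) : \bar R :=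
  ((\int[p.1.1]_(l in S2) (dotp (b_ D) l)%:E)
   - (\sum_(i < d) OT_ p.1.1 i)
   + (dotp (q_in D) p.1.2)%:E + (dotp (q_eq D) p.2)%:E)%E.

Definition slack (x : 'cV[R]_k1) (f : 'I_d -> R -> R)
    (l : 'cV[R]_(m_in + m_eq)) : R :=
  dotp (Q_ D *m x + b_ D) l + \sum_(i < d) f i (p_dot i l).

Definition vio (x : 'cV[R]_k1) (f : 'I_d -> R -> R) : \bar R :=
  ereal_sup [set (slack x f l)%:E | l in S2].

Record constraints (tau : probability (borelcV R (m_in + m_eq)) R)
    (xi_in : 'cV[R]_n_in) (xi_eq : 'cV[R]_n_eq)
    (V : set 'cV[R]_(m_in + m_eq)) (eps_OT : R)
    (x : 'cV[R]_k1) (f : 'I_d -> R -> R) : Prop := Constraints {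
  C1_holds : forall l, supp tau l -> slack x f l = 0;
  C2_holds : forall l, (V `\` supp tau) l -> slack x f l <= 0;
  C3_holds : dotp (L_in D *m x - q_in D) xi_in = 0;
  C4_holds : dotp (c1 D + mean_QT tau - (L_in D)^T *m xi_in
                   - (L_eq D)^T *m xi_eq) x = 0;
  C5_holds : forall i,
    (- (\int[mu_ D i]_(w in Omega_ i) conjugate (f i) w)
     - (\int[nu_ tau i]_z (f i z)%:E) >= OT_ tau i - eps_OT%:E)%E;
  C6_holds : forall i z, subdifferential (f i) z `<=` Omega_ i
}.

End Problem.

(* Main.v *)
Require Import Defs.
From HB Require Import structures.
From mathcomp Require Import all_boot all_order all_algebra.
From mathcomp Require Import all_classical all_reals all_analysis.
From mathcomp Require Import measurable_realfun ring lra.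

Set Implicit Arguments.
Unset Strict Implicit.
Unset Printing Implicit Defensive.

Import Order.TTheory GRing.Theory Num.Theory.
Import numFieldNormedType.Exports.

Local Open Scope classical_set_scope.
Local Open Scope ring_scope.

(** Why the theorem holds.

Fix [x] and [f] satisfying the constraints and write [v] for the violation,
the supremum of the slack
  [slack l = <Q x + b, l> + sum_i f_i (<p_i, l>)]
over the polyhedron [S2] of second-stage dual vectors.

Part (i).  The slack vanishes on the support of [tau], a nonempty subset of
[S2], so [0 <= v].  The slack is convex in [l], and it does not increase along
recession directions: every subgradient of [f_i] lies in [Omega_i], so moving
from [l] to [l + r] raises the slack by at most [<Q x + P w + b, r>] for some
scenario [w] in [Omega], and this is nonpositive when [r] is a recession
direction, because the second-stage cost [C2 x w] is finite
([slack_recession]).  A convex function that does not increase along recession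
directions attains its maximum over a polyhedron at a vertex of its pointed
part ([max_at_vertex]).  Hence [v] is finite and attained in [V_extr].

Part (ii).  Let [K = sum_i int f_i^* d mu_i].  For every coupling, the
Fenchel-Young inequality [z w <= f_i z + f_i^* w] integrates to
  [OT_i >= - int f_i^* d mu_i - int f_i d nu_i]
([kantorovich_le_cost], [OT_ge]).  Inserting this into the objective of any
dual feasible point, then [slack <= v] and the feasibility of [x], bounds the
objective by [v + <c1, x> + K] ([dual_objective_le]).  For the given point,
the slack integrates to zero, each potential [f_i] is optimal up to [eps_OT],
and complementary slackness turns the two linear inequalities into equalities,
so its objective is at least [<c1, x> + K - d eps_OT] ([dual_objective_ge]).
The difference of the two bounds is [v + d eps_OT].  Subtracting [K] requires
it to be finite, which follows from the near-optimality of [f_i] once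
[-oo < OT_i] is known ([OT_gtNy], [integrable_conjugate]).  The set where the
slack is positive misses [V] because the constraints make the slack
nonpositive on all of [V]. *)

(** * The Euclidean inner product *)

Section Dot.
Context {R : realType}.

Lemma dotpE n (u v : 'cV[R]_n) : dotp u v = (u^T *m v) 0 0.
Proof. by rewrite mxE; apply: eq_bigr => i _; rewrite mxE. Qed.

Lemma dotpC n (u v : 'cV[R]_n) : dotp u v = dotp v u.
Proof. by apply: eq_bigr => i _; rewrite mulrC. Qed.

Lemma dotpDr n (u v w : 'cV[R]_n) : dotp u (v + w) = dotp u v + dotp u w.
Proof. by rewrite !dotpE mulmxDr mxE. Qed.

Lemma dotpZr n (u v : 'cV[R]_n) a : dotp u (a *: v) = a * dotp u v.
Proof. by rewrite !dotpE -scalemxAr mxE. Qed.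

Lemma dotpNr n (u v : 'cV[R]_n) : dotp u (- v) = - dotp u v.
Proof. by rewrite -scaleN1r dotpZr mulN1r. Qed.

Lemma dotpBr n (u v w : 'cV[R]_n) : dotp u (v - w) = dotp u v - dotp u w.
Proof. by rewrite dotpDr dotpNr. Qed.

Lemma dotpDl n (u v w : 'cV[R]_n) : dotp (v + w) u = dotp v u + dotp w u.
Proof. by rewrite dotpC dotpDr !(dotpC u). Qed.

Lemma dotpBl n (u v w : 'cV[R]_n) : dotp (v - w) u = dotp v u - dotp w u.
Proof. by rewrite dotpC dotpBr !(dotpC u). Qed.

Lemma dotp_mulmx m n (M : 'M[R]_(m, n)) u v :
  dotp (M *m u) v = dotp u (M^T *m v).
Proof. by rewrite !dotpE trmx_mul mulmxA. Qed.

Lemma dotp_eq0 n (u : 'cV[R]_n) : dotp u u = 0 -> u = 0.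
Proof.
move=> /eqP; rewrite psumr_eq0 => [/allP u0|i _]; last first.
  by rewrite -expr2 sqr_ge0.
apply/matrixP => i j; rewrite ord1 mxE; apply/eqP.
by have := u0 i (mem_index_enum i); rewrite mulf_eq0 orbb.
Qed.

Lemma dotp_col_mx m n (u1 v1 : 'cV[R]_m) (u2 v2 : 'cV[R]_n) :
  dotp (col_mx u1 u2) (col_mx v1 v2) = dotp u1 v1 + dotp u2 v2.
Proof. by rewrite !dotpE tr_col_mx mul_row_col mxE. Qed.

Lemma dotp_delta n (i : 'I_n) (v : 'cV[R]_n) : dotp (delta_mx i 0) v = v i 0.
Proof.
rewrite /dotp (bigD1 i)//= mxE !eqxx mul1r big1 ?addr0// => j ji.
by rewrite mxE (negbTE ji) mul0r.
Qed.

Lemma ler_dotp n (u v w : 'cV[R]_n) : lecv 0 w -> lecv u v ->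
  dotp u w <= dotp v w.
Proof.
move=> w0 uv; apply: ler_sum => i _; apply: ler_wpM2r; last exact: uv.
by have := w0 i; rewrite mxE.
Qed.

End Dot.

(** * Convex functions of one real variable *)

Section RealConvex.
Context {R : realType}.
Implicit Types (f : R -> R) (x y z : R).

Lemma C_cvxP f : C_cvx f -> forall (t x y : R), 0 <= t <= 1 ->
  f (t * x + (1 - t) * y) <= t * f x + (1 - t) * f y.
Proof.
move=> [_ cvxf] t x y /andP[t0 t1].
have t01 : Itv.spec (@Itv.num_sem R) (Itv.Real `[0%Z, 1%Z]) t.
  by rewrite /Itv.num_sem/= ger0_real//= in_itv/= t0 t1.
by have := cvxf (Itv.mk t01) x y (mem_setT _) (mem_setT _).
Qed.

Lemma chord_slopes f : C_cvx f -> forall y z w, y < z -> z < w ->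
  (f z - f y) / (z - y) <= (f w - f z) / (w - z).
Proof.
move=> cf y z w yz zw.
have yw : 0 < w - y by rewrite subr_gt0 (lt_trans yz).
have t01 : 0 <= (w - z) / (w - y) <= 1.
  by rewrite ler_pdivrMr// mul1r divr_ge0; lra.
have := C_cvxP cf y w t01.
have -> : (w - z) / (w - y) * y + (1 - (w - z) / (w - y)) * w = z.
  by field; lra.
have -> : (w - z) / (w - y) * f y + (1 - (w - z) / (w - y)) * f w =
   ((w - z) * f y + (z - y) * f w) / (w - y) by field; lra.
rewrite ler_pdivlMr// => H.
rewrite ler_pdivrMr ?subr_gt0// mulrAC ler_pdivlMr ?subr_gt0//.
nra.
Qed.

(** By [chord_slopes], the slopes of the chords ending at [z] are bounded by
those of the chords starting at [z]; the supremum of the former separates the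
two families. *)
Lemma subdifferential_nonempty f z : C_cvx f -> subdifferential f z !=set0.
Proof.
move=> cf; pose S := [set (f z - f y) / (z - y) | y in [set y | y < z]].
have ubS w : z < w -> ubound S ((f w - f z) / (w - z)).
  by move=> zw _ [y /= yz <-]; exact: chord_slopes.
have S0 : S !=set0.
  by exists ((f z - f (z - 1)) / (z - (z - 1))), (z - 1) => //=; lra.
have hS : has_sup S.
  by split=> //; exists ((f (z + 1) - f z) / (z + 1 - z)); apply: ubS; lra.
exists (sup S) => y /=; case: (ltgtP y z) => [yz|zy|->]; last by lra.
- have : (f z - f y) / (z - y) <= sup S.
    by apply: ub_le_sup; [exact: hS.2|exists y].
  by rewrite ler_pdivrMr ?subr_gt0//; nra.
- have : sup S <= (f y - f z) / (y - z) by apply: ge_sup => //; exact: ubS.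
  by rewrite ler_pdivlMr ?subr_gt0//; nra.
Qed.

(** The subgradient is taken at the end point [z + h], so the inequality bounds
the increase of [f] from above instead of from below. *)
Lemma le_affine_subdifferential f s z h : subdifferential f (z + h) s ->
  f (z + h) <= f z + s * h.
Proof. by move=> /(_ z); lra. Qed.

(** Comparing [0] and [z] with a subgradient at either point bounds the
variation of [f] on both sides. *)
Lemma linear_growth f (a b : R) : C_cvx f ->
  (forall z, subdifferential f z `<=` `[a, b]) ->
  forall z, `|f z| <= `|f 0| + (`|a| + `|b|) * `|z|.
Proof.
move=> cf fab z.
have sM w s : subdifferential f w s -> `|s * z| <= (`|a| + `|b|) * `|z|.
  move=> /fab /=; rewrite in_itv/= => /andP[as_ sb]; rewrite normrM.
  apply: ler_wpM2r => //; rewrite ler_norml.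
  have := ler_norm b; have := ler_norm (- a); rewrite normrN.
  have := normr_ge0 a; have := normr_ge0 b; lra.
have [s0 Hs0] := subdifferential_nonempty 0 cf.
have [s1 Hs1] := subdifferential_nonempty z cf.
have := Hs0 z; have := Hs1 0.
have := sM _ _ Hs0; have := sM _ _ Hs1.
rewrite !ler_norml => /andP[? ?] /andP[? ?].
have := ler_norm (f 0); have := ler_norm (- f 0); rewrite normrN.
rewrite subr0 sub0r mulrN => *; lra.
Qed.

End RealConvex.

(** * Maximizing a convex function over a polyhedron *)

Section Polyhedron.
Context {R : realType} {n : nat} {I : finType}.
Variables (a : I -> 'cV[R]_n) (b : I -> R).

Definition polyhedron : set 'cV[R]_n := [set l | forall j, dotp (a j) l <= b j].

(** If some [dotp (a j) r] were positive, a long enough step along [r] would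
violate the [j]-th constraint. *)
Lemma recession_polyhedronP r : polyhedron !=set0 ->
  recession_cone polyhedron r <-> forall j, dotp (a j) r <= 0.
Proof.
move=> [l0 Pl0]; split=> [rr j|ar l t Pl t0 j].
- rewrite leNgt; apply/negP => ar.
  have t0 : 0 <= (`|b j - dotp (a j) l0| + 1) / dotp (a j) r.
    by rewrite divr_ge0 ?addr_ge0// ltW.
  have := rr l0 _ Pl0 t0 j; rewrite dotpDr dotpZr divfK ?gt_eqF//.
  have := ler_norm (b j - dotp (a j) l0); lra.
- rewrite dotpDr dotpZr.
  have := Pl j; have := ar j; nra.
Qed.

Lemma lineality_polyhedronP r : polyhedron !=set0 ->
  lineality polyhedron r <-> forall j, dotp (a j) r = 0.
Proof.
move=> P0; rewrite /lineality/= !recession_polyhedronP//; split=> [[H1 H2] j|H].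
  by have := H1 j; have := H2 j; rewrite dotpNr; lra.
by split=> j; rewrite ?dotpNr H ?oppr0.
Qed.

(** With the vectors [a j] as the columns of [B], the left kernel of [B] and the
span of the [a j] meet trivially, because a vector in both is orthogonal to
itself; their ranks add up to [n], so their sum is the whole space. *)
Lemma orthogonal_decomposition (l : 'cV[R]_n) :
  exists w r : 'cV[R]_n, [/\ l = w + r, forall j, dotp (a j) r = 0
    & forall s : 'cV[R]_n, (forall j, dotp (a j) s = 0) -> dotp w s = 0].
Proof.
pose B : 'M[R]_(n, #|I|) := \matrix_(k, i) a (enum_val i) k 0.
have BP (u : 'rV[R]_n) : u *m B = 0 <-> forall j, dotp (a j) u^T = 0.
  split=> [uB j|uB].
    have := congr1 (fun M : 'rV_ _ => M 0 (enum_rank j)) uB.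
    rewrite !mxE => <-; apply: eq_bigr => k _.
    by rewrite !mxE enum_rankK mulrC.
  apply/matrixP => i j; rewrite ord1 !mxE -[RHS](uB (enum_val j)).
  by apply: eq_bigr => k _; rewrite !mxE mulrC.
have cap0 : (kermx B :&: B^T = 0)%MS.
  apply/eqP/rowV0P => u; rewrite sub_capmx => /andP[/sub_kermxP uB /submxP[w uw]].
  apply: trmx_inj; rewrite trmx0; apply: dotp_eq0.
  by rewrite dotpE trmxK {2}uw trmx_mul trmxK mulmxA uB mul0mx mxE.
have full : row_full (kermx B + B^T)%MS.
  rewrite /row_full; apply/eqP.
  have := mxrank_sum_cap (kermx B) B^T; rewrite cap0 mxrank0 addn0 => ->.
  by rewrite mxrank_ker mxrank_tr subnK// rank_leq_row.
have /sub_addsmxP[[x y] /= lxy] : (l^T <= kermx B + B^T)%MS by exact: submx_full.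
exists (y *m B^T)^T, (x *m kermx B)^T; split.
- by rewrite -linearD/= addrC -lxy trmxK.
- by apply/BP; rewrite -mulmxA mulmx_ker mulmx0.
- move=> s sa; rewrite dotpE trmxK -mulmxA.
  suff -> : B^T *m s = 0 by rewrite mulmx0 mxE.
  by apply: trmx_inj; rewrite trmx_mul trmxK trmx0; apply/BP; rewrite trmxK.
Qed.

(* The slice of the polyhedron orthogonal to its lineality space contains no
   line, and the polyhedron is the sum of the two. *)
Local Notation pointed := (polyhedron `&` orthogonal_set (lineality polyhedron)).

Definition active (l : 'cV[R]_n) : {set I} := [set j | dotp (a j) l == b j].

(** The step length is the smallest ratio of the remaining room of a constraint
to its growth rate along [r]; the constraint that realizes it becomes active,
and those already active stay so because [r] is orthogonal to them. *)
Lemma hit_boundary l r j0 : polyhedron l -> 0 < dotp (a j0) r ->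
  (forall j, j \in active l -> dotp (a j) r = 0) ->
  exists t : R, [/\ 0 < t, polyhedron (l + t *: r)
    & active l \proper active (l + t *: r)].
Proof.
move=> Pl ar0 lr.
pose ratio j := (b j - dotp (a j) l) / dotp (a j) r.
pose j1 := [arg min_(j < j0 | 0 < dotp (a j) r) ratio j]%O.
have [ar1 min1] : 0 < dotp (a j1) r /\
    forall j, 0 < dotp (a j) r -> ratio j1 <= ratio j.
  by rewrite /j1; case: arg_minP.
have nact1 : j1 \notin active l by apply/negP => /lr; lra.
have l1 : dotp (a j1) l < b j1.
  by move: nact1; rewrite inE => nact; rewrite lt_neqAle nact Pl.
exists (ratio j1); split.
- by rewrite divr_gt0// subr_gt0.
- move=> j; rewrite dotpDr dotpZr.
  have [arj|arj] := ltP 0 (dotp (a j) r).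
    by have := min1 j arj; rewrite [X in _ <= X]/ratio ler_pdivlMr//; lra.
  have : 0 < ratio j1 by rewrite divr_gt0// subr_gt0.
  by have := Pl j; nra.
- apply/properP; split.
    apply/fintype.subsetP => j jl; rewrite inE dotpDr dotpZr (lr _ jl) mulr0 addr0.
    by move: jl; rewrite inE.
  exists j1 => //; rewrite inE dotpDr dotpZr /ratio divfK ?(gt_eqF ar1)//.
  by apply/eqP; lra.
Qed.

Lemma orthogonal_setDZ (S : set 'cV[R]_n) u v (t : R) :
  orthogonal_set S u -> orthogonal_set S v -> orthogonal_set S (u + t *: v).
Proof.
move=> Su Sv r Sr; rewrite dotpC dotpDr dotpZr dotpC Su// dotpC Sv//.
by rewrite mulr0 addr0.
Qed.

Lemma orthogonal_setN (S : set 'cV[R]_n) v :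
  orthogonal_set S v -> orthogonal_set S (- v).
Proof. by move=> Sv r Sr; rewrite dotpC dotpNr dotpC Sv// oppr0. Qed.

(** The line through [u] and [v] satisfies the common active constraints with
equality, so the segment from [v] to [u] can be prolonged beyond [u], which
then is not extreme unless [u = v]. *)
Lemma active_vertex_inj u v :
  extreme_points pointed u -> extreme_points pointed v ->
  active u = active v -> u = v.
Proof.
move=> [pu eu] [pv ev] uv; apply/eqP; rewrite -subr_eq0; apply/negPn/negP => uv0.
have P0 : polyhedron !=set0 by exists u; exact: pu.1.
have orth : orthogonal_set (lineality polyhedron) (u - v).
  by rewrite -scaleN1r; apply: orthogonal_setDZ; [exact: pu.2|exact: pv.2].
have {uv} aorth j : j \in active u -> dotp (a j) (u - v) = 0.
  move=> ju; have := ju; rewrite uv !inE => /eqP jv.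
  by move: ju; rewrite inE dotpBr jv => /eqP ->; rewrite subrr.
have [s [s0 Ps]] : exists s : R, 0 < s /\ polyhedron (u + s *: (u - v)).
  have [[j uvj]|up] := pselect (exists j, 0 < dotp (a j) (u - v)).
    by have [s [s0 Ps _]] := hit_boundary pu.1 uvj aorth; exists s.
  exists 1; split=> // j; rewrite dotpDr dotpZr mul1r.
  have : ~ 0 < dotp (a j) (u - v) by move=> ?; apply: up; exists j.
  by move=> /negP; rewrite -leNgt; have := pu.1 j; lra.
have ps : pointed (u + s *: (u - v)).
  by split=> //; apply: orthogonal_setDZ => //; exact: pu.2.
have s01 : 0 < (1 + s)^-1 < 1.
  by rewrite invr_gt0 invf_lt1; lra.
have [|_ vu] := eu (u + s *: (u - v)) v (1 + s)^-1 ps pv s01.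
  by apply/matrixP => i j; rewrite !mxE; field; lra.
by move: uv0; rewrite vu subrr eqxx.
Qed.

Section Maximum.
Variable phi : 'cV[R]_n -> R.
Hypothesis phi_convex : forall (y z : 'cV[R]_n) (t : R), 0 <= t <= 1 ->
  phi (t *: y + (1 - t) *: z) <= t * phi y + (1 - t) * phi z.
Hypothesis phi_recession : forall l r : 'cV[R]_n,
  (forall j, dotp (a j) r <= 0) -> phi (l + r) <= phi l.

(** The direction [r] leaves the active constraints active.  If both [r] and
[- r] hit the boundary, convexity gives one of the two boundary points a value
at least [phi l]; if only one does, the opposite direction is a recession
direction, along which [phi] does not increase.  Both cannot be free, since
[r] would then be orthogonal to itself. *)
Lemma activate_more l r : pointed l -> orthogonal_set (lineality polyhedron) r ->
  r != 0 -> (forall j, j \in active l -> dotp (a j) r = 0) ->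
  exists l', [/\ pointed l', phi l <= phi l' & active l \proper active l'].
Proof.
move=> [Pl Ll] Lr r0 lr.
have P0 : polyhedron !=set0 by exists l.
have lNr j : j \in active l -> dotp (a j) (- r) = 0.
  by move=> /lr; rewrite dotpNr => ->; rewrite oppr0.
have LNr := orthogonal_setN Lr.
(* Here - s is a recession direction, so phi does not decrease along s. *)
have one_sided s j0 : orthogonal_set (lineality polyhedron) s ->
    (forall j, j \in active l -> dotp (a j) s = 0) -> 0 < dotp (a j0) s ->
    (forall j, 0 <= dotp (a j) s) ->
    exists l', [/\ pointed l', phi l <= phi l' & active l \proper active l'].
  move=> Ls ls aj0 as0; have [t [t0 Pt act]] := hit_boundary Pl aj0 ls.
  exists (l + t *: s); split => //; first by split=> //; exact: orthogonal_setDZ.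
  rewrite -{1}(addrK (t *: s) l); apply: phi_recession => j.
  by rewrite dotpNr dotpZr oppr_le0 mulr_ge0// ltW.
have [[j1 r1]|up] := pselect (exists j, 0 < dotp (a j) r); last first.
  have up' j : dotp (a j) r <= 0.
    by rewrite leNgt; apply/negP => ?; apply: up; exists j.
  have [[j2 r2]|dn] := pselect (exists j, 0 < dotp (a j) (- r)).
    by apply: (one_sided (- r) j2) => // j; rewrite dotpNr oppr_ge0.
  exfalso; move/eqP: r0; apply; apply: dotp_eq0; apply: Lr.
  apply/lineality_polyhedronP => // j; apply/eqP; rewrite eq_le up'/=.
  by rewrite leNgt; apply/negP => ?; apply: dn; exists j; rewrite dotpNr oppr_gt0.
have [[j2 r2]|dn] := pselect (exists j, 0 < dotp (a j) (- r)); last first.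
  apply: (one_sided r j1) => // j; rewrite leNgt; apply/negP => ?; apply: dn.
  by exists j; rewrite dotpNr oppr_gt0.
have [t1 [t10 Pt1 act1]] := hit_boundary Pl r1 lr.
have [t2 [t20 Pt2 act2]] := hit_boundary Pl r2 lNr.
have Lt1 := orthogonal_setDZ t1 Ll Lr.
have Lt2 := orthogonal_setDZ t2 Ll LNr.
have t12 : 0 < t1 + t2 by rewrite addr_gt0.
(* l divides the segment between the two boundary points in the ratio
   t1 : t2. *)
have th01 : 0 <= t2 / (t1 + t2) <= 1.
  by rewrite ler_pdivrMr// mul1r divr_ge0; lra.
have := phi_convex (l + t1 *: r) (l + t2 *: - r) th01.
have -> : (t2 / (t1 + t2)) *: (l + t1 *: r) +
    (1 - t2 / (t1 + t2)) *: (l + t2 *: - r) = l.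
  by apply/matrixP => i j; rewrite !mxE; field; lra.
have [le12|lt12] := leP (phi (l + t1 *: r)) (phi (l + t2 *: - r)) => H.
  exists (l + t2 *: - r); split => //; nra.
exists (l + t1 *: r); split => //; nra.
Qed.

(** Among the points of the pointed part with value at least [phi l], one with
the largest number of active constraints is a vertex: if it were interior to a
segment, [activate_more] along that segment would activate one more. *)
Lemma vertex_dominates l : polyhedron l ->
  exists2 v, extreme_points pointed v & phi l <= phi v.
Proof.
move=> Pl; have P0 : polyhedron !=set0 by exists l.
have [w [r [lwr ar wr]]] := orthogonal_decomposition l.
have pw : pointed w.
  split=> [j|s /lineality_polyhedronP -/(_ P0)]; last exact: wr.
  by have := Pl j; rewrite lwr dotpDr ar addr0.
have phiw : phi l <= phi w by rewrite lwr; apply: phi_recession => j; rewrite ar.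
pose good k := `[< exists v, [/\ pointed v, phi l <= phi v & #|active v| = k] >].
have ex_good : exists k, good k by exists #|active w|; apply/asboolP; exists w.
have bnd k : good k -> (k <= #|I|)%N by move=> /asboolP[v [_ _ <-]]; exact: max_card.
case: (ex_maxnP ex_good bnd) => k /asboolP[v [pv phiv actv]] kmax.
exists v => //; split=> // y z t py pz /andP[t0 t1] vyz.
suff yz : y = z.
  by move: vyz; rewrite yz -scalerDl addrC subrK scale1r => ->.
apply/eqP; rewrite -subr_eq0; apply/negPn/negP => yz0.
have Lyz : orthogonal_set (lineality polyhedron) (y - z).
  by rewrite -scaleN1r; apply: orthogonal_setDZ; [exact: py.2|exact: pz.2].
have [|l' [pl' phil' prop]] := activate_more pv Lyz yz0.
  move=> j; rewrite inE vyz (dotpDr _ (t *: y)) !dotpZr => /eqP; rewrite dotpBr.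
  by have := py.1 j; have := pz.1 j; nra.
have := proper_card prop; rewrite actv ltnNge => /negP; apply.
apply: kmax; apply/asboolP; exists l'; split=> //.
exact: le_trans phil'.
Qed.

(** Vertices are determined by their active sets, so there are finitely many,
and a best one among them dominates every point by [vertex_dominates]. *)
Lemma max_at_vertex : polyhedron !=set0 ->
  exists2 v, extreme_points pointed v & forall l, polyhedron l -> phi l <= phi v.
Proof.
move=> [l0 Pl0]; have [v0 ev0 _] := vertex_dominates Pl0.
(* The vertex with active set J, or an arbitrary vertex if there is none. *)
pose vtx J := xget v0 [set v | extreme_points pointed v /\ active v = J].
have vtx_ext J : extreme_points pointed (vtx J).
  by rewrite /vtx; case: xgetP => [v _ []|].
have vtxE v : extreme_points pointed v -> vtx (active v) = v.
  move=> ev; rewrite /vtx; case: xgetP => [u _ [eu au]|/(_ v)]; last by case.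
  exact: active_vertex_inj.
pose J := [arg max_(J > finset.set0) phi (vtx J)]%O.
exists (vtx J) => // l /vertex_dominates[v ev]; move/le_trans; apply.
by rewrite /J; case: arg_maxP => // K _ /(_ (active v) isT); rewrite vtxE.
Qed.

End Maximum.
End Polyhedron.

(** * Borel probability measures on column vectors *)

Section Borel.
Context {R : realType} {n : nat}.
Implicit Types (g : 'cV[R]_n -> R).

Lemma open_measurable_cV (A : set 'cV[R]_n) : open A ->
  measurable (A : set (borelcV R n)).
Proof. by move=> oA; apply: sub_sigma_algebra. Qed.

Lemma continuous_measurable_cV g : continuous g ->
  measurable_fun [set: borelcV R n] (g : borelcV R n -> measurableTypeR R).
Proof.
move=> /continuousP cg; apply: (measurability _ (RGenOpens.measurableE R)).
move=> _ [_ [x [y ->] <-]]; rewrite setTI; apply: open_measurable_cV.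
exact/cg/interval_open.
Qed.

Lemma continuous_dotp (u : 'cV[R]_n) : continuous (dotp u).
Proof.
apply: continuous_big; first exact: add_continuous.
move=> i _ y; apply: (@continuous_comp _ _ _ (fun M : 'cV[R]_n => M i 0)).
  exact: coord_continuous.
exact: mulrl_continuous.
Qed.

Lemma measurable_dotp (u : 'cV[R]_n) :
  measurable_fun [set: borelcV R n] (dotp u : borelcV R n -> measurableTypeR R).
Proof. by apply: continuous_measurable_cV; exact: continuous_dotp. Qed.

Lemma ler_norm_coord (y : 'cV[R]_n) i : `|y i 0| <= `|y|.
Proof.
rewrite [leRHS]mx_normrE.
exact: (le_bigmax 0 (fun ij : 'I_n * 'I_1 => `|y ij.1 ij.2|) (i, 0)).
Qed.

Lemma ler_norm_dotp (u y : 'cV[R]_n) : `|dotp u y| <= (\sum_i `|u i 0|) * `|y|.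
Proof.
rewrite mulr_suml; apply: le_trans (ler_norm_sum _ _ _) _.
apply: ler_sum => i _; rewrite normrM.
by apply: ler_wpM2l => //; exact: ler_norm_coord.
Qed.

Lemma measurable_polyhedron (I : finType) (a : I -> 'cV[R]_n) (b : I -> R) :
  measurable (polyhedron a b : set (borelcV R n)).
Proof.
have -> : polyhedron a b = \bigcap_(j in [set: I]) (dotp (a j) @^-1` `]-oo, b j]).
  apply/seteqP; split=> [l Pl j _|l Pl j]; first by rewrite /= in_itv/=; exact: Pl.
  by have := Pl j Logic.I; rewrite /= in_itv.
apply: fin_bigcap_measurable => // j _.
rewrite -[X in measurable X]setTI; apply: (measurable_dotp (a j)) => //.
Qed.

(** Every point outside the support has a null open neighbourhood, which
encloses the point in a ball of rational centre and radius [1 / (k + 1)].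
There are countably many such balls. *)
Lemma supp_null (mu : probability (borelcV R n) R) :
  mu.-negligible (~` supp mu).
Proof.
pose null_ball (qk : 'cV[rat]_n * nat) : set 'cV[R]_n :=
  let B := ball (map_mx ratr qk.1 : 'cV[R]_n) (qk.2.+1%:R^-1 : R) in
  if mu B == 0%E then B else set0.
pose F k := if unpickle k is Some qk then null_ball qk else set0.
have negF k : mu.-negligible (F k).
  rewrite /F; case: unpickle => [qk|]; last exact: negligible_set0.
  rewrite /null_ball; case: eqP => [B0|_]; last exact: negligible_set0.
  apply/negligibleP => //; apply: open_measurable_cV; exact: ball_open.
apply: negligibleS (negligible_bigcup negF) => x /=.
move=> /existsNP[U /not_implyP[oU /not_implyP[Ux muU]]].
have muU0 : mu U = 0%E.
  by apply/eqP; rewrite eq_le measure_ge0 andbT leNgt; exact/negP.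
have /nbhs_ballP[e /= e0 eU] : nbhs x U by exact: open_nbhs_nbhs.
have [k ke] : exists k, 2 * k.+1%:R^-1 < e.
  have e20 : 0 < e / 2 by lra.
  near \oo => k; exists k; rewrite -ltr_pdivlMl// mulrC.
  by near: k; exact: near_infty_natSinv_lt (PosNum e20).
pose r := k.+1%:R^-1 : R.
have r0 : 0 < r by rewrite invr_gt0.
pose y : 'cV[R]_n := x.
have /choice[q qx] : forall i : 'I_n, exists q : rat, `|ratr q - y i 0| < r.
  move=> i; have [|q] := @rat_in_itvoo R (y i 0 - r) (y i 0 + r).
    by lra.
  rewrite in_itv/= => /andP[q1 q2]; exists q.
  by rewrite ltr_norml; lra.
pose Q := \col_i q i.
have Qx : ball (map_mx ratr Q : 'cV[R]_n) r x.
  by split=> // i j; rewrite ord1 !mxE; exact: qx.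
exists (pickle (Q, k)) => //; rewrite /F pickleK /null_ball/=.
suff -> : mu (ball (map_mx ratr Q : 'cV[R]_n) r) = 0%E by rewrite eqxx.
apply: (subset_measure0 _ _ _ muU0).
- by apply: open_measurable_cV; exact: ball_open.
- exact: open_measurable_cV.
- move=> z Qz; apply: eU; apply: (@le_ball _ _ _ (r + r)).
    by rewrite -mulr2n -mulr_natl ltW.
  by apply: ball_triangle Qz; exact: ball_sym.
Unshelve. all: by end_near. Qed.

End Borel.

Section Support.
Context {R : realType} {n : nat} (tau : probability (borelcV R n) R).

Lemma supp_nonempty : supp tau !=set0.
Proof.
apply/set0P/negP => /eqP s0; have := supp_null tau.
rewrite s0 setC0 => /negligibleP -/(_ measurableT) tau0.
by have := @probability_setT _ _ _ tau; rewrite tau0 => /esym/eqP; rewrite onee_eq0.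
Qed.

Lemma integral_supp_eq0 (h : borelcV R n -> R) :
  tau.-integrable setT (fun y => (h y)%:E) ->
  (forall y, supp tau y -> h y = 0) -> (\int[tau]_y (h y)%:E = 0)%E.
Proof.
move=> ih h0; have [N [mN N0 supN]] := supp_null tau.
rewrite (negligible_integral mN measurableT ih N0) setTD.
rewrite (eq_integral (cst 0%E)) ?integral0// => y /set_mem Ny.
by rewrite h0//; apply: contrapT => sy; apply: Ny; exact: supN.
Qed.

End Support.

(** * Integration against a measure concentrated on a set *)

Section Integration.
Context d (T : measurableType d) (R : realType).
Implicit Types (mu : probability T R) (Y : set T).

Lemma prob_on_setC mu Y : measurable Y -> prob_on mu Y -> mu (~` Y) = 0%E.
Proof. by move=> mY muY; rewrite probability_setC// muY subee. Qed.

Lemma integral_prob_on mu Y (h : T -> \bar R) : measurable Y -> prob_on mu Y ->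
  mu.-integrable setT h -> (\int[mu]_(y in Y) h y = \int[mu]_y h y)%E.
Proof.
move=> mY muY ih.
have mYC := measurableC mY.
by rewrite [RHS](negligible_integral mYC _ ih (prob_on_setC mY muY))// setTD setCK.
Qed.

Lemma integrable_prob_on mu Y (h : T -> \bar R) : measurable Y -> prob_on mu Y ->
  measurable_fun setT h -> mu.-integrable Y h -> mu.-integrable setT h.
Proof.
move=> mY muY mh ih.
apply/(negligible_integrable (measurableC mY) measurableT mh (prob_on_setC mY muY)).
by rewrite setTD setCK.
Qed.

(** The lower bound makes the integral of the negative part finite, so the
integral of the positive part is finite too. *)
Lemma integrable_bounded_below mu Y (h : T -> \bar R) (c : R) : measurable Y ->
  measurable_fun Y h -> (forall y, Y y -> (c%:E <= h y)%E) ->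
  (\int[mu]_(y in Y) h y < +oo)%E -> mu.-integrable Y h.
Proof.
move=> mY mh ch hoo; apply/integrableP; split=> //.
have neg_fin : (\int[mu]_(y in Y) h^\- y < +oo)%E.
  apply: (@le_lt_trans _ _ (\int[mu]_(y in Y) `|c|%:E)%E).
    apply: ge0_le_integral => //.
    - exact: measurable_funeneg.
    - move=> y Yy; rewrite funenegE ge_max lee_fin normr_ge0 andbT leeNl.
      apply: le_trans (ch _ Yy); rewrite -EFinN lee_fin lerNl.
      by rewrite -normrN ler_norm.
  rewrite integral_cst// -ge0_fin_numE.
    by rewrite fin_numM// fin_num_measure.
  by rewrite mule_ge0.
have neg0 : (0 <= \int[mu]_(y in Y) h^\- y)%E by exact: integral_ge0.
have pos_fin : (\int[mu]_(y in Y) h^\+ y < +oo)%E.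
  have neg_num : (\int[mu]_(y in Y) h^\- y)%E \is a fin_num by rewrite ge0_fin_numE.
  move: hoo; rewrite integralE ltey => h1; rewrite ltey; apply: contra h1.
  by move=> /eqP ->; rewrite addye// -(fineK neg_num).
rewrite (eq_integral (fun y => h^\+ y + h^\- y)%E); last first.
  by move=> y _; rewrite -[LHS]/((abse \o h) y) fune_abse.
rewrite ge0_integralD//.
- exact: lte_add_pinfty.
- exact: measurable_funepos.
- exact: measurable_funeneg.
Qed.

End Integration.

(** * Optimal transport and the Fenchel-Young inequality *)

Section Marginal.
Context d1 d2 (X : measurableType d1) (Y : measurableType d2) (R : realType).

(** [nu] need only agree with the image of [g] under [phi] on measurable sets,
which is how couplings specify their marginals. *)
Lemma integrable_marginal (g : probability X R) (nu : probability Y R)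
    (phi : X -> Y) (h : Y -> \bar R) :
  measurable_fun setT phi -> measurable_fun setT h ->
  (forall A, measurable A -> g (phi @^-1` A) = nu A) ->
  nu.-integrable setT h ->
  g.-integrable setT (h \o phi) /\ (\int[g]_x (h \o phi) x = \int[nu]_y h y)%E.
Proof.
move=> mphi mh gnu ih.
pose phiM : {mfun X >-> Y} := HB.pack phi (isMeasurableFun.Build _ _ _ _ _ mphi).
have E (k : Y -> \bar R) : (\int[pushforward g phi]_y k y = \int[nu]_y k y)%E.
  apply: (@eq_measure_integral _ _ _ setT nu (distribution g phiM)) => A mA _.
  exact: gnu.
have igh : g.-integrable setT (h \o phi).
  apply/integrableP; split; first exact: measurableT_comp.
  have := ge0_integral_pushforward mphi g (D := setT) (f := abse \o h).
  rewrite preimage_setT E => <-//.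
  - by case/integrableP: ih.
  - exact: measurableT_comp.
  - by move=> y _; exact: abse_ge0.
split=> //.
have := integral_pushforward mphi (mu := g) (D := setT) mh.
by rewrite preimage_setT E => <-.
Qed.

End Marginal.

Section Kantorovich.
Context {R : realType}.
Implicit Types (f : R -> R) (a b : R).

(** As a supremum of affine functions, the conjugate is lower
semicontinuous. *)
Lemma measurable_conjugate f :
  measurable_fun setT (conjugate f : measurableTypeR R -> \bar R).
Proof.
apply: lower_semicontinuous_measurable.
apply/lower_semicontinuousP => c.
have -> : [set w | (c%:E < conjugate f w)%E] =
    \bigcup_(z in setT) [set w | c < z * w - f z].
  apply/seteqP; split=> [w /ereal_sup_gt[_ [z _ <-]]|w [z _ /= cz]] /=.
    by rewrite lte_fin => cz; exists z.
  apply: (@lt_le_trans _ _ (z * w - f z)%:E); first by rewrite lte_fin.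
  by apply: ereal_sup_ubound; exists z.
apply: bigcup_open => z _.
apply: (@open_comp _ _ (fun w => z * w - f z) [set t | c < t]); last exact: open_gt.
move=> w _; apply: (@cvgB _ R); [exact: mulrl_continuous|exact: cvg_cst].
Qed.

Lemma fenchel_young f z w : ((z * w - f z)%:E <= conjugate f w)%E.
Proof. by apply: ereal_sup_ubound; exists z. Qed.

(** The Fenchel-Young inequality integrated against a coupling.  The first
moment of [nu] and the boundedness of the interval carrying [mu] make the
transport cost integrable. *)
Lemma kantorovich_le_cost f a b (mu nu : probability (measurableTypeR R) R)
    (g : probability (measurableTypeR R * measurableTypeR R)%type R) :
  prob_on mu `[a, b] -> coupling mu nu g ->
  measurable_fun setT (f : measurableTypeR R -> measurableTypeR R) ->
  mu.-integrable `[a, b] (conjugate f) ->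
  nu.-integrable setT (fun z => (f z)%:E) ->
  nu.-integrable setT (fun z => (`|z : R|)%:E) ->
  (- (\int[mu]_(w in `[a, b]) conjugate f w) - \int[nu]_z (f z)%:E <=
   \int[g]_(p in `[a, b] `*` setT) (- (p.2 * p.1))%:E)%E.
Proof.
move=> muab gmn mf imu inu inorm.
have mab : measurable (`[a, b] : set (measurableTypeR R)) by exact: measurable_itv.
have mcf := measurable_conjugate f.
have imuT := integrable_prob_on mab muab mcf imu.
have gfst A : measurable A -> g (fst @^-1` A) = mu A.
  by move=> /gmn[<- _]; congr (g _); apply/seteqP; split=> [x|x []].
have gsnd A : measurable A -> g (snd @^-1` A) = nu A.
  by move=> /gmn[_ <-]; congr (g _); apply/seteqP; split=> [x|x []].
pose DD : set (measurableTypeR R * measurableTypeR R) := `[a, b] `*` setT.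
have mDD : measurable DD by exact: measurableX.
have gDD : prob_on g DD by rewrite /prob_on /DD (gmn _ mab).1.
have mEf : measurable_fun setT ((fun z => (f z)%:E) : measurableTypeR R -> \bar R).
  exact/measurable_EFinP.
have mEn : measurable_fun setT ((fun z => (`|z : R|)%:E) : measurableTypeR R -> \bar R).
  by apply/measurable_EFinP; exact: normr_measurable.
have [i1 e1] := integrable_marginal measurable_fst mcf gfst imuT.
have [i2 e2] := integrable_marginal measurable_snd mEf gsnd inu.
have [i3 _] := integrable_marginal measurable_snd mEn gsnd inorm.
have sub := @integrableS _ _ _ g setT DD _ measurableT mDD (fun _ _ => Logic.I).
rewrite (integral_prob_on mab muab imuT) -e1 -e2.
rewrite -(integral_prob_on mDD gDD i1) -(integral_prob_on mDD gDD i2).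
have i1D := sub _ i1; have i2D := sub _ i2; have i3D := sub _ i3.
rewrite -integralN//; last exact: integrable_add_def.
rewrite -integralB//; last exact: integrableN.
apply: le_integral => //.
- by apply: integrableB => //; exact: integrableN.
- have i4D := integrableZl mDD (`|a| + `|b|) i3D.
  apply: (le_integrable mDD _ _ i4D).
    apply: measurable_funTS.
    apply/measurable_EFinP.
    apply: measurableT_comp => //.
    apply: measurable_funM; [exact: measurable_snd|exact: measurable_fst].
  move=> [w z] [/= wab _]; rewrite lee_fin normrN normrM mulrC.
  rewrite normrM normr_id [X in _ <= X * _]ger0_norm ?addr_ge0//.
  apply: ler_wpM2r => //; move: wab; rewrite in_itv/= => /andP[aw wb].
  rewrite ler_norml; have := ler_norm b; have := ler_norm (- a).
  by rewrite normrN; have := normr_ge0 a; have := normr_ge0 b; lra.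
- move=> [w z] _ /=; have := fenchel_young f z w.
  case: (conjugate f w) => [r| |]//=.
  + by rewrite !lee_fin; lra.
  + by move=> _; rewrite addNye leNye.
Qed.

End Kantorovich.

(** * Measures with a finite first moment *)

Section Moments.
Context {R : realType} {n : nat}.
Variables (Y : set 'cV[R]_n) (tau : probability (borelcV R n) R).
Hypotheses (mY : measurable (Y : set (borelcV R n))) (P1Y : P1_on Y tau).

Lemma P1_integrable_norm :
  tau.-integrable setT (fun y : borelcV R n => (`|y : 'cV[R]_n|)%:E).
Proof.
have mn : measurable_fun setT (fun y : borelcV R n => (`|y : 'cV[R]_n|)%:E).
  apply/measurable_EFinP; apply: continuous_measurable_cV.
  exact: norm_continuous.
apply: (integrable_prob_on mY P1Y.1 mn).
apply: (integrable_bounded_below (c := 0) mY); last exact: P1Y.2.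
- exact: measurable_funTS.
- by move=> y _; rewrite lee_fin.
Qed.

Lemma integrable_linear_growth (g : 'cV[R]_n -> R) (a b : R) :
  measurable_fun [set: borelcV R n] (g : borelcV R n -> measurableTypeR R) ->
  (forall y, `|g y| <= a + b * `|y|) ->
  tau.-integrable setT (fun y : borelcV R n => (g y)%:E).
Proof.
move=> mg gab.
have i1 := finite_measure_integrable_cst tau a (@measurableT _ (borelcV R n)).
have i2 := integrableD measurableT i1 (integrableZl measurableT b P1_integrable_norm).
apply: (le_integrable measurableT _ _ i2); first exact/measurable_EFinP.
move=> y _; rewrite /= lee_fin.
by apply: le_trans (gab y) _; exact: ler_norm.
Qed.

Lemma integrable_dotp (u : 'cV[R]_n) :
  tau.-integrable setT (fun y : borelcV R n => (dotp u y)%:E).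
Proof.
apply: (@integrable_linear_growth _ 0 (\sum_i `|u i 0|)).
  exact: measurable_dotp.
by move=> y; rewrite add0r; exact: ler_norm_dotp.
Qed.

Definition mean : 'cV[R]_n :=
  \col_i fine (\int[tau]_y (dotp (delta_mx i 0 : 'cV[R]_n) y)%:E)%E.

Lemma integral_dotp (u : 'cV[R]_n) :
  (\int[tau]_y (dotp u y)%:E = (dotp u mean)%:E)%E.
Proof.
rewrite (eq_integral (fun y : borelcV R n => \sum_(i < n)
    ((u i 0)%:E * (dotp (delta_mx i 0 : 'cV[R]_n) y)%:E))%E); last first.
  move=> y _; rewrite /dotp -sumEFin; apply: eq_bigr => i _.
  by rewrite -[in RHS]/(dotp _ y) dotp_delta EFinM.
rewrite integral_sum//; last first.
  by move=> i; apply: integrableZl => //; exact: integrable_dotp.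
rewrite /dotp -sumEFin; apply: eq_bigr => i _.
rewrite integralZl//; last exact: integrable_dotp.
rewrite mxE EFinM fineK//; apply: integrable_fin_num => //; exact: integrable_dotp.
Qed.

Lemma integral_le_cst (h : 'cV[R]_n -> R) (v : R) :
  tau.-integrable setT (fun y : borelcV R n => (h y)%:E) ->
  (forall y, Y y -> h y <= v) -> (\int[tau]_y (h y)%:E <= v%:E)%E.
Proof.
move=> ih hv; rewrite -(integral_prob_on mY P1Y.1 ih).
have icst := finite_measure_integrable_cst tau v mY.
apply: (@le_trans _ _ (\int[tau]_(y in Y) v%:E)%E).
  apply: (le_integral mY _ icst).
    exact: (integrableS measurableT mY).
  by move=> y /set_mem Yy; rewrite lee_fin; exact: hv.
rewrite integral_cst// [X in (_ * X)%E](_ : _ = 1%E) ?mule1//.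
exact: P1Y.1.
Qed.

End Moments.

(** * The violation is attained at a vertex *)

Section Data.
Context {R : realType} {d k1 n_in n_eq m_in m_eq k2 : nat}.
Context (D : dro_data R d k1 n_in n_eq m_in m_eq k2).
Local Notation vec := 'cV[R]_(m_in + m_eq).
Local Notation prob := (probability (borelcV R (m_in + m_eq)) R).

(** The inequality description of [S2]; the left summand indexes the sign
constraints on the first block. *)
Definition S2_row (j : 'I_m_in + 'I_k2) : vec :=
  match j with
  | inl i => delta_mx (lshift m_eq i) 0
  | inr i => col_mx (col i (A_in D)) (col i (A_eq D))
  end.

Definition S2_rhs (j : 'I_m_in + 'I_k2) : R :=
  match j with inl _ => 0 | inr i => c2 D i 0 end.

Lemma S2_polyhedron : S2 D = polyhedron S2_row S2_rhs.
Proof.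
have rowE (M : 'M[R]_(_, k2)) i (v : 'cV[R]_ _) : dotp (col i M) v = (M^T *m v) i 0.
  by rewrite mxE; apply: eq_bigr => k _; rewrite !mxE.
apply/seteqP; split=> [l [lin [leq [-> lin0 lc]]] [i|i]|l Pl] /=.
- by rewrite dotp_delta col_mxEu; have := lin0 i; rewrite mxE.
- by rewrite dotp_col_mx !rowE; have := lc i; rewrite mxE.
- exists (usubmx l), (dsubmx l); split; first by rewrite vsubmxK.
    by move=> i; have := Pl (inl i); rewrite /= dotp_delta !mxE.
  move=> i; have := Pl (inr i).
  by rewrite /= -{1}(vsubmxK l) dotp_col_mx !rowE [X in _ -> X <= _]mxE.
Qed.

Lemma measurable_S2 : measurable (S2 D : set (borelcV R (m_in + m_eq))).
Proof. by rewrite S2_polyhedron; exact: measurable_polyhedron. Qed.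

Lemma p_dotZD i (y z : vec) (s t : R) :
  p_dot D i (s *: y + t *: z) = s * p_dot D i y + t * p_dot D i z.
Proof. by rewrite /p_dot dotpDr !dotpZr. Qed.

Lemma slack_convex x f : (forall i, C_cvx (f i)) ->
  forall (y z : vec) (t : R), 0 <= t <= 1 ->
  slack D x f (t *: y + (1 - t) *: z) <=
  t * slack D x f y + (1 - t) * slack D x f z.
Proof.
move=> cf y z t t01; rewrite /slack dotpDr !dotpZr !mulrDr addrACA lerD2l.
rewrite !mulr_sumr -big_split/=; apply: ler_sum => i _.
by rewrite p_dotZD; exact: C_cvxP.
Qed.

(** Otherwise the linear functional defining [C2 D x w] would be unbounded on
the ray issuing from a point of [S2] in direction [r]. *)
Lemma second_stage_recession x w (r : vec) : dro_setting D -> S1 D x ->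
  Omega D w -> (forall j, dotp (S2_row j) r <= 0) ->
  dotp (Q_ D *m x + P_ D *m w + b_ D) r <= 0.
Proof.
move=> [_ _ _ S20 fin] S1x Ow ar; rewrite leNgt; apply/negP => r0.
have [l0 Sl0] := S20.
have rr : recession_cone (S2 D) r.
  by rewrite S2_polyhedron recession_polyhedronP// -S2_polyhedron.
set q := Q_ D *m x + P_ D *m w + b_ D in r0.
have C2x : (C2 D x w < +oo)%E.
  by apply: le_lt_trans fin; apply: ereal_sup_ubound; exists x => //; exists w.
have C2l l : S2 D l -> ((dotp q l)%:E <= C2 D x w)%E.
  by move=> Sl; apply: ereal_sup_ubound; exists l.
have C2fin : C2 D x w \is a fin_num.
  by rewrite fin_real// C2x andbT; apply: lt_le_trans (C2l _ Sl0); rewrite ltNyr.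
have := C2l; rewrite -(fineK C2fin); set M := fine _ => C2M.
have t0 : 0 <= (`|M - dotp q l0| + 1) / dotp q r.
  by rewrite divr_ge0 ?addr_ge0// ltW.
have := C2M _ (rr _ _ Sl0 t0); rewrite lee_fin dotpDr dotpZr divfK ?(gt_eqF r0)//.
by have := ler_norm (M - dotp q l0); lra.
Qed.

(** Subgradients of the [f i] at the coordinates of [l + r] form a scenario [w]
in [Omega]; the increase of the slack is at most the linear form of
[second_stage_recession] at [w]. *)
Lemma slack_recession x f : dro_setting D -> S1 D x -> (forall i, C_cvx (f i)) ->
  (forall i z, subdifferential (f i) z `<=` Omega_ D i) ->
  forall l r : vec, (forall j, dotp (S2_row j) r <= 0) ->
  slack D x f (l + r) <= slack D x f l.
Proof.
move=> st S1x cf sub l r ar.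
have /choice[s sP] : forall i, exists s,
    subdifferential (f i) (p_dot D i l + p_dot D i r) s.
  by move=> i; exact: subdifferential_nonempty.
pose w : 'cV[R]_d := \col_i s i.
have Ow : Omega D w by move=> i; rewrite mxE; exact: sub (sP i).
have := second_stage_recession st S1x Ow ar.
rewrite !dotpDl => le0.
have Pw : dotp (P_ D *m w) r = \sum_i s i * p_dot D i r.
  rewrite dotp_mulmx; apply: eq_bigr => i _; rewrite mxE; congr (_ * _).
  by rewrite mxE; apply: eq_bigr => k _; rewrite !mxE.
rewrite /slack !dotpDr !dotpDl.
have : \sum_i f i (p_dot D i (l + r)) <=
       \sum_i f i (p_dot D i l) + \sum_i s i * p_dot D i r.
  rewrite -big_split; apply: ler_sum => i _.
  rewrite /p_dot dotpDr; exact: le_affine_subdifferential (sP i).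
by rewrite -Pw; move: le0; lra.
Qed.

Lemma vio_attained x f : dro_setting D -> S1 D x -> (forall i, C_cvx (f i)) ->
  (forall i z, subdifferential (f i) z `<=` Omega_ D i) ->
  exists2 l, V_extr D l & (slack D x f l)%:E = vio D x f.
Proof.
move=> st S1x cf sub.
have P0 : polyhedron S2_row S2_rhs !=set0 by rewrite -S2_polyhedron; case: st.
have [v ev vmax] := max_at_vertex (slack_convex x cf)
  (slack_recession st S1x cf sub) P0.
rewrite -S2_polyhedron in ev vmax; exists v => //.
apply/eqP; rewrite eq_le; apply/andP; split.
  by apply: ereal_sup_ubound; exists v => //; exact: ev.1.1.
by apply: ge_ereal_sup => _ [l Sl <-]; rewrite lee_fin; exact: vmax.
Qed.

End Data.

(** * Weak duality and near-optimality *)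

Section Duality.
Context {R : realType} {d k1 n_in n_eq m_in m_eq k2 : nat}.
Context (D : dro_data R d k1 n_in n_eq m_in m_eq k2).
Local Notation vec := 'cV[R]_(m_in + m_eq).
Local Notation prob := (probability (borelcV R (m_in + m_eq)) R).

Lemma measurable_p_dot i :
  measurable_fun [set: borelcV R (m_in + m_eq)] (p_dot D i).
Proof. exact: measurable_dotp. Qed.

Section LinearGrowth.
Variables (tau : prob) (i : 'I_d) (h : R -> R) (a b : R).
Hypotheses (P1tau : P1_on (S2 D) tau) (ch : continuous h).
Hypothesis hab : forall z, `|h z| <= a + b * `|z|.

Lemma integrable_comp_p_dot :
  tau.-integrable setT (fun l : borelcV R _ => (h (p_dot D i l))%:E).
Proof.
apply: (@integrable_linear_growth _ _ _ _ (measurable_S2 D) P1tau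
  (fun l => h (p_dot D i l)) a (`|b| * \sum_k `|col i (P_ D) k 0|)).
  apply: measurableT_comp; last exact: measurable_p_dot.
  exact: continuous_measurable_fun.
move=> l; apply: le_trans (hab _) _; rewrite lerD2l -mulrA.
apply: (@le_trans _ _ (`|b| * `|p_dot D i l|)).
  by apply: ler_wpM2r => //; exact: ler_norm.
by apply: ler_wpM2l => //; exact: ler_norm_dotp.
Qed.

(** The projection bundled with its measurability, so that [nu_ D tau i] is
recognized as a probability measure. *)
Definition p_dot_mfun : {mfun borelcV R (m_in + m_eq) >-> measurableTypeR R} :=
  HB.pack (p_dot D i) (isMeasurableFun.Build _ _ _ _ _ (measurable_p_dot i)).

Lemma integrable_nu :
  (distribution tau p_dot_mfun).-integrable setT (fun z => (h z)%:E).
Proof.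
apply: (integrable_pushforward (measurable_p_dot i)) => //.
  by apply/measurable_EFinP; exact: continuous_measurable_fun.
by rewrite preimage_setT; exact: integrable_comp_p_dot.
Qed.

Lemma integral_nu :
  (\int[nu_ D tau i]_z (h z)%:E = \int[tau]_l (h (p_dot D i l))%:E)%E.
Proof.
rewrite [LHS](integral_pushforward (measurable_p_dot i) (mu := tau)
  (D := setT)) ?preimage_setT//.
  by apply/measurable_EFinP; exact: continuous_measurable_fun.
exact: integrable_comp_p_dot.
Qed.

Lemma integral_nu_fin_num : (\int[nu_ D tau i]_z (h z)%:E)%E \is a fin_num.
Proof.
by rewrite integral_nu; apply: integrable_fin_num => //; exact: integrable_comp_p_dot.
Qed.

End LinearGrowth.

Lemma OT_ge (tau : prob) i (h : R -> R) (a b : R) :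
  P1_on (S2 D) tau -> prob_on (mu_ D i) (Omega_ D i) -> continuous h ->
  (forall z, `|h z| <= a + b * `|z|) ->
  (mu_ D i).-integrable (Omega_ D i) (conjugate h) ->
  (- (\int[mu_ D i]_(w in Omega_ D i) conjugate h w)
   - \int[nu_ D tau i]_z (h z)%:E <= OT_ D tau i)%E.
Proof.
move=> P1tau muO ch hab imu; apply: le_ereal_inf_tmp => _ [g gc <-].
apply: (kantorovich_le_cost (nu := distribution tau (p_dot_mfun i))) => //.
- exact: continuous_measurable_fun.
- exact: integrable_nu hab.
- apply: (@integrable_nu _ _ _ 0 1) => //; first exact: norm_continuous.
  by move=> z; rewrite normr_id add0r mul1r.
Qed.

(** [OT_ge] for [h z = M * `|z|]: the conjugate of [h] vanishes on [[-M, M]],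
which contains [Omega_ D i]. *)
Lemma OT_gtNy (tau : prob) i : P1_on (S2 D) tau ->
  prob_on (mu_ D i) (Omega_ D i) -> (-oo < OT_ D tau i)%E.
Proof.
move=> P1tau muO.
pose M := `|lo D i| + `|hi D i|; pose h (z : R) := M * `|z|.
have M0 : 0 <= M by rewrite addr_ge0.
have ch : continuous h.
  by move=> z; apply: continuous_comp; [exact: norm_continuous|exact: mulrl_continuous].
have hab z : `|h z| <= 0 + M * `|z| by rewrite add0r ger0_norm ?mulr_ge0.
have mO : measurable (Omega_ D i : set (measurableTypeR R)) by exact: measurable_itv.
have conj0 w : Omega_ D i w -> conjugate h w = 0%E.
  rewrite /Omega_/= in_itv/= => /andP[lw wh]; apply/eqP; rewrite eq_le; apply/andP; split.
    apply: ge_ereal_sup => _ [z _ <-]; rewrite lee_fin subr_le0.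
    apply: le_trans (ler_norm _) _; rewrite normrM mulrC; apply: ler_wpM2r => //.
    rewrite ler_norml /M; have := ler_norm (hi D i); have := ler_norm (- lo D i).
    by rewrite normrN; have := normr_ge0 (lo D i); have := normr_ge0 (hi D i); lra.
  by have := fenchel_young h 0 w; rewrite /h normr0 mulr0 mul0r subr0.
have imu : (mu_ D i).-integrable (Omega_ D i) (conjugate h).
  apply: (eq_integrable mO (cst 0%E)); last exact: integrable0.
  by move=> w /set_mem Ow; rewrite conj0.
apply: lt_le_trans (OT_ge P1tau muO ch hab imu).
have := integral_nu_fin_num i P1tau ch hab.
have := integrable_fin_num mO imu.
by move=> /fineK <- /fineK <-; rewrite -!EFinN -EFinD ltNyr.
Qed.

Lemma mean_QTE (tau : prob) : P1_on (S2 D) tau ->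
  mean_QT D tau = (Q_ D)^T *m mean tau.
Proof.
move=> P1tau; apply/matrixP => j k; rewrite ord1 {k} mxE.
have rowE (v : vec) : ((Q_ D)^T *m v) j 0 = dotp (col j (Q_ D)) v.
  by rewrite mxE; apply: eq_bigr => k _; rewrite !mxE.
have mS := measurable_S2 D.
rewrite rowE; apply: EFin_inj; rewrite -(integral_dotp mS P1tau).
have iQ := integrable_dotp mS P1tau (col j (Q_ D)).
rewrite -(integral_prob_on mS P1tau.1 iQ) /Rintegral fineK.
  by apply: eq_integral => l _; rewrite rowE.
rewrite (eq_integral (fun l : borelcV R _ => (dotp (col j (Q_ D)) l)%:E)).
  by apply: integrable_fin_num => //; exact: (integrableS measurableT mS).
by move=> l _; rewrite rowE.
Qed.

Section Potentials.
Variables (x : 'cV[R]_k1) (f : 'I_d -> R -> R).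
Hypotheses (setting : dro_setting D) (S1x : S1 D x).
Hypothesis cf : forall i, C_cvx (f i).
Hypothesis sub : forall i z, subdifferential (f i) z `<=` Omega_ D i.
Hypothesis imu : forall i,
  (mu_ D i).-integrable (Omega_ D i) (conjugate (f i)).

Definition potential_mu i : R :=
  fine (\int[mu_ D i]_(w in Omega_ D i) conjugate (f i) w)%E.
Definition potential_nu (tau : prob) i : R :=
  fine (\int[nu_ D tau i]_z (f i z)%:E)%E.

Let mO i : measurable (Omega_ D i : set (measurableTypeR R)).
Proof. exact: measurable_itv. Qed.

Lemma potential_muE i :
  (\int[mu_ D i]_(w in Omega_ D i) conjugate (f i) w = (potential_mu i)%:E)%E.
Proof. by rewrite fineK//; exact: (integrable_fin_num (mO i) (imu i)). Qed.

Let growth i := linear_growth (cf i) (@sub i).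

Lemma potential_nuE tau i : P1_on (S2 D) tau ->
  (\int[nu_ D tau i]_z (f i z)%:E = (potential_nu tau i)%:E)%E.
Proof.
move=> P1tau; rewrite fineK//.
exact: (integral_nu_fin_num i P1tau (cf i).1 (growth i)).
Qed.

Lemma integral_slack tau : P1_on (S2 D) tau ->
  tau.-integrable setT (fun l : borelcV R _ => (slack D x f l)%:E) /\
  (\int[tau]_l (slack D x f l)%:E =
    (dotp (Q_ D *m x + b_ D) (mean tau) + \sum_i potential_nu tau i)%:E)%E.
Proof.
move=> P1tau; have mS := measurable_S2 D.
pose g i (l : borelcV R (m_in + m_eq)) := (f i (p_dot D i l))%:E.
have ig i : tau.-integrable setT (g i).
  exact: (integrable_comp_p_dot i P1tau (cf i).1 (growth i)).
have idot := integrable_dotp mS P1tau (Q_ D *m x + b_ D).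
have isum := integrable_sum measurableT (index_enum 'I_d) (P := xpredT) (fun i _ => ig i).
have slackE (l : vec) : ((slack D x f l)%:E =
    (dotp (Q_ D *m x + b_ D) l)%:E + \sum_(i < d) g i l)%E.
  by rewrite /slack EFinD sumEFin.
split.
  by apply: (eq_integrable measurableT _ _ _ (integrableD measurableT idot isum)) => l _.
under eq_integral => l _ do rewrite slackE.
rewrite integralD// (integral_dotp mS P1tau).
rewrite integral_sum// EFinD; congr (_ + _)%E; rewrite -sumEFin; apply: eq_bigr => i _.
by rewrite -potential_nuE// (integral_nu i P1tau (cf i).1 (growth i)).
Qed.

(** The three estimates are [OT_ge] for each [i], [slack <= v] integrated
against the first component of [p], and the pairing of the dual constraint
with [x >= 0] and of [L_in x <= q_in] with the nonpositive multiplier. *)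
Lemma dual_objective_le (v : R) p : dual_feasible D p ->
  (forall l, S2 D l -> slack D x f l <= v) ->
  (dual_objective D p <= (v + dotp (c1 D) x + \sum_i potential_mu i)%:E)%E.
Proof.
case: p => [[tau xi_in] xi_eq] [/= P1tau xi0 xic] sv.
have mS := measurable_S2 D.
have [isl esl] := integral_slack P1tau.
have := integral_le_cst mS P1tau isl sv; rewrite esl lee_fin => Hs.
have HOT : ((\sum_i (- potential_mu i - potential_nu tau i))%:E <=
    \sum_(i < d) OT_ D tau i)%E.
  rewrite -sumEFin; apply: lee_sum => i _.
  rewrite EFinB EFinN -potential_muE -potential_nuE//.
  have [_ muO _ _ _] := setting.
  exact: (OT_ge P1tau (muO i) (cf i).1 (growth i) (imu i)).
rewrite /dual_objective/=.
rewrite (integral_prob_on mS P1tau.1 (integrable_dotp mS P1tau _)).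
rewrite (integral_dotp mS P1tau).
apply: (@le_trans _ _ ((dotp (b_ D) (mean tau))%:E -
   (\sum_i (- potential_mu i - potential_nu tau i))%:E +
    (dotp (q_in D) xi_in)%:E + (dotp (q_eq D) xi_eq)%:E)%E).
  by do 2 apply: leeD => //; apply: leeB.
rewrite -EFinB -!EFinD lee_fin.
case: S1x => x0 Lx Lqx.
have := ler_dotp x0 xic; rewrite mean_QTE// !dotpDl.
rewrite !(dotp_mulmx _^T) !trmxK dotpC (dotpC xi_eq) Lqx.
have := ler_dotp (u := L_in D *m x) (v := q_in D) (w := - xi_in).
rewrite !dotpNr => H1.
have xiN : lecv 0 (- xi_in) by move=> k; have := xi0 k; rewrite !mxE oppr_ge0.
have := H1 xiN Lx.
move: Hs; rewrite dotpDl dotp_mulmx (dotpC x) dotp_mulmx trmxK.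
rewrite big_split/= !sumrN (dotpC (mean tau)).
lra.
Qed.

End Potentials.
End Duality.

Section Optimality.
Context {R : realType} {d k1 n_in n_eq m_in m_eq k2 : nat}.
Context (D : dro_data R d k1 n_in n_eq m_in m_eq k2).
Variables (tau : probability (borelcV R (m_in + m_eq)) R).
Variables (xi_in : 'cV[R]_n_in) (xi_eq : 'cV[R]_n_eq).
Variables (V : set 'cV[R]_(m_in + m_eq)) (eps : R).
Variables (x : 'cV[R]_k1) (f : 'I_d -> R -> R).
Hypotheses (setting : dro_setting D) (S1x : S1 D x).
Hypothesis cf : forall i, C_cvx (f i).
Hypothesis P1tau : P1_on (S2 D) tau.
Hypothesis con : constraints D tau xi_in xi_eq V eps x f.

Let mO i : measurable (Omega_ D i : set (measurableTypeR R)).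
Proof. exact: measurable_itv. Qed.

Let growth i := linear_growth (cf i) (C6_holds con (i := i)).

(** If the conjugate had infinite integral, the left-hand side of the
near-optimality constraint would be [-oo], and so would [OT_ D tau i]. *)
Lemma integrable_conjugate i :
  (mu_ D i).-integrable (Omega_ D i) (conjugate (f i)).
Proof.
have [_ muO _ _ _] := setting.
apply: (integrable_bounded_below (c := - f i 0) (mO i)).
- exact: measurable_funTS (measurable_conjugate (f i)).
- by move=> w _; have := fenchel_young (f i) 0 w; rewrite mul0r sub0r.
have := C5_holds con i; rewrite ltey; apply: contraTneq => ->.
rewrite /= addNye -ltNge.
have := OT_gtNy P1tau (muO i).
by case: (OT_ D tau i) => [r| |]//= _; rewrite ?ltNyr.
Qed.

(** The same computation as in [dual_objective_le], with equality in the slack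
and complementary slackness estimates and a loss of [eps] for each [OT_]. *)
Lemma dual_objective_ge :
  ((dotp (c1 D) x + \sum_i potential_mu D f i - d%:R * eps)%:E <=
   dual_objective D (tau, xi_in, xi_eq))%E.
Proof.
have [_ muO _ _ _] := setting.
have mS := measurable_S2 D.
have sub := C6_holds con.
have [isl esl] := integral_slack x cf sub P1tau.
have := integral_supp_eq0 isl (C1_holds con); rewrite esl => -[Hs].
have HOT : (\sum_(i < d) OT_ D tau i <=
    (\sum_i (- potential_mu D f i - potential_nu D f tau i + eps))%:E)%E.
  rewrite -sumEFin; apply: lee_sum => i _.
  have := C5_holds con i.
  rewrite (potential_muE integrable_conjugate) (potential_nuE cf sub i P1tau).
  by rewrite leeBlDr// !EFinD !EFinN.
rewrite /dual_objective/=.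
rewrite (integral_prob_on mS P1tau.1 (integrable_dotp mS P1tau _)).
rewrite (integral_dotp mS P1tau).
apply: (@le_trans _ _ ((dotp (b_ D) (mean tau))%:E -
   (\sum_i (- potential_mu D f i - potential_nu D f tau i + eps))%:E +
    (dotp (q_in D) xi_in)%:E + (dotp (q_eq D) xi_eq)%:E)%E); last first.
  by do 2 apply: leeD => //; apply: leeB.
rewrite -EFinB -!EFinD lee_fin.
case: S1x => _ _ Lqx.
have := C3_holds con; have := C4_holds con.
rewrite mean_QTE// !dotpBl dotpDl !(dotp_mulmx _^T) !trmxK.
rewrite Lqx (dotpC xi_eq) (dotpC xi_in).
move: Hs; rewrite dotpDl dotp_mulmx (dotpC x) dotp_mulmx trmxK.
rewrite big_split/= big_split/= !sumrN (dotpC (mean tau)) sumr_const card_ord mulr_natl.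
lra.
Qed.

End Optimality.

Theorem theorem3p4 (R : realType) (d k1 n_in n_eq m_in m_eq k2 : nat)
    (D : dro_data R d k1 n_in n_eq m_in m_eq k2)
    (d_ge2 : (2 <= d)%N) (k1_gt0 : (0 < k1)%N)
    (k2star_gt0 : (0 < m_in + m_eq)%N) (k2_gt0 : (0 < k2)%N)
    (setting : dro_setting D)
    (C_DRO_gtNy : (-oo < C_DRO D)%E)
    (tau : probability (borelcV R (m_in + m_eq)) R)
    (xi_in : 'cV[R]_n_in) (xi_eq : 'cV[R]_n_eq)
    (feasible : dual_feasible D (tau, xi_in, xi_eq))
    (supp_fin : finite_set (supp tau))
    (V : set 'cV[R]_(m_in + m_eq))
    (V_fin : finite_set V) (suppV : supp tau `<=` V) (VS2 : V `<=` S2 D)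
    (eps_OT : R) (eps_OT_gt0 : 0 < eps_OT) :
  (* (i) *)
  (forall (x : 'cV[R]_k1) (f : 'I_d -> R -> R),
     S1 D x -> (forall i, C_cvx (f i)) ->
     constraints D tau xi_in xi_eq V eps_OT x f ->
     (0 <= vio D x f < +oo)%E /\
     exists2 l, V_extr D l & (slack D x f l)%:E = vio D x f) /\
  (* (ii) *)
  (forall (x : 'cV[R]_k1) (f : 'I_d -> R -> R),
     S1 D x -> (forall i, C_cvx (f i)) ->
     constraints D tau xi_in xi_eq V eps_OT x f ->
     eps_maximizer (dual_feasible D) (dual_objective D)
       (vio D x f + (d%:R * eps_OT)%:E)%E (tau, xi_in, xi_eq) /\
     ((0 < vio D x f)%E ->
      [set l | S2 D l /\ 0 < slack D x f l] `&` V = set0)).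
Proof.
split=> x f S1x cf con; have [v ev vE] := vio_attained setting S1x cf (C6_holds con).
- split; last by exists v.
  apply/andP; split; last by rewrite -vE ltry.
  have [l sl] := supp_nonempty tau.
  apply: ereal_sup_ubound; exists l; first exact/VS2/suppV.
  by rewrite (C1_holds con sl).
have P1tau : P1_on (S2 D) tau by case: feasible.
have imu := integrable_conjugate setting P1tau con.
have vmax l : S2 D l -> slack D x f l <= slack D x f v.
  by move=> Sl; rewrite -lee_fin vE; apply: ereal_sup_ubound; exists l.
split.
  split=> //.
  have upper : (ereal_sup [set dual_objective D q | q in dual_feasible D] <=
      (slack D x f v + dotp (c1 D) x + \sum_i potential_mu D f i)%:E)%E.
    apply: ge_ereal_sup => _ [q qfeas <-].
    exact: (dual_objective_le setting S1x cf (C6_holds con) imu qfeas vmax).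
  rewrite -vE -EFinD leeBlDr//.
  apply: le_trans upper _.
  apply: le_trans (leeD2r _ (dual_objective_ge setting S1x cf P1tau con)).
  by rewrite -EFinD lee_fin; lra.
move=> _; apply/seteqP; split=> // l [[_ sl0] Vl].
have [sl|nsl] := pselect (supp tau l).
  by move: sl0; rewrite (C1_holds con sl) ltxx.
by have := C2_holds con (conj Vl nsl); rewrite leNgt sl0.
Qed.
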